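(* Let $t, r$ be integers with $2\le t\le r$. For every $\varepsilon>0$ there exists $\delta>0$ such that if $G$ is a graph on $n$ vertices having $$k_t(G) \ge (1+\varepsilon)\,\frac{n}{r+1}\binom{r+1}{t},$$ then $s_{r+1}(G)\ge \delta n$.
   Context: Graphs are finite and simple. $k_t(G)$ denotes the number of copies of the complete graph $K_t$ in $G$ (i.e. the number of $t$-cliques of $G$). $S_r$ denotes the star $K_{1,r}$, and $s_r(G)$ denotes the number of copies of $S_r$ in $G$, given by $s_r(G)=\sum_{v\in V(G)}\binom{d(v)}{r}$, where $d(v)$ is the degree of $v$. The constant $\delta$ depends only on $t,r,\varepsilon$ (not on $n$ or $G$). *)

(* Defs.v *)
From mathcomp Require Import all_boot all_order all_algebra.

Set Implicit Arguments.
Unset Strict Implicit.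
Unset Printing Implicit Defensive.

(* A finite simple graph is a symmetric irreflexive [e : rel T] on [T : finType]. *)

Definition clique (T : finType) (e : rel T) (A : {set T}) : bool :=
  [forall x in A, forall y in A, (x != y) ==> e x y].

Definition num_cliques (T : finType) (e : rel T) (t : nat) : nat :=
  #|[set A : {set T} | (#|A| == t) && clique e A]|.

Definition degree (T : finType) (e : rel T) (v : T) : nat :=
  #|[set u | e v u]|.

(* Stars are counted by centre and leaf set; for [r = 1] every edge is
   therefore counted twice, once for each endpoint. *)
Definition num_stars (T : finType) (e : rel T) (r : nat) : nat :=
  \sum_(v : T) 'C(degree e v, r).

(* Main.v *)
Require Import Defs.
From mathcomp Require Import all_boot all_order all_algebra.
From mathcomp Require Import ring lra.

(** The theorem is a double count. Every [t]-clique through [v] is [v] together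
    with [t - 1] of its neighbours, so [t * k_t(G) <= \sum_v 'C(d(v), t - 1)]
    ([mul_num_cliques_le]). If all degrees were at most [r], the right-hand side
    would be at most [n * 'C(r, t - 1) = t * (n / (r + 1)) * 'C(r + 1, t)], so
    the hypothesis says that the vertices of degree above [r] account for an
    excess of at least [eps * n * 'C(r, t - 1)]. At such a vertex,
    ['C(d, t - 1)] is at most the constant ['C(r + 1, t - 1)] times
    ['C(d, r + 1)] ([leq_bin_mul_bin]), the number of [(r + 1)]-stars centred
    there. Hence [s_(r + 1)(G) >= delta * n] with
    [delta = eps * 'C(r, t - 1) / 'C(r + 1, t - 1)]. *)

Set Implicit Arguments.
Unset Strict Implicit.
Unset Printing Implicit Defensive.

Import Order.TTheory GRing.Theory Num.Theory.
Local Open Scope ring_scope.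

(** Deleting [v] embeds the [k.+1]-cliques through [v] into the [k]-subsets of
    the neighbourhood of [v]. *)
Lemma card_cliques_at_le (T : finType) (e : rel T) (k : nat) (v : T) :
  (#|[set A : {set T} | [&& #|A| == k.+1, clique e A & v \in A]]|
    <= 'C(degree e v, k))%N.
Proof.
rewrite /degree -cards_draws.
rewrite -(@card_in_imset _ _ (fun A : {set T} => A :\ v)); last first.
  move=> A B; rewrite !inE => /and3P[_ _ vA] /and3P[_ _ vB] eqAB.
  by rewrite -(setD1K vA) -(setD1K vB) eqAB.
apply/subset_leq_card/subsetP => _ /imsetP[A + ->].
rewrite !inE => /and3P[/eqP cardA /forall_inP clA vA]; apply/andP; split.
  apply/subsetP => u; rewrite !inE => /andP[uv uA].
  by move/forall_inP/(_ u uA)/implyP: (clA v vA); apply; rewrite eq_sym.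
by move: cardA; rewrite (cardsD1 v) vA add1n => -[->].
Qed.

(** Pairs of a [k.+1]-clique and one of its vertices, counted from the clique
    on the left and bounded vertex by vertex on the right. *)
Lemma mul_num_cliques_le (T : finType) (e : rel T) (k : nat) :
  (k.+1 * num_cliques e k.+1 <= \sum_(v : T) 'C(degree e v, k))%N.
Proof.
rewrite /num_cliques; set K := [set A | _].
have -> : (k.+1 * #|K| = \sum_(A in K) \sum_(v in A) 1)%N.
  rewrite mulnC -sum_nat_const; apply: eq_bigr => A.
  by rewrite inE sum1_card => /andP[/eqP-> _].
rewrite (exchange_big_dep predT) //=; apply: leq_sum => v _.
rewrite sum1dep_card; apply: leq_trans (card_cliques_at_le e k v).
by apply/subset_leq_card/subsetP => A; rewrite !inE andbA.
Qed.

(** Choosing an [m]-subset of a [d]-set and then a [k]-subset inside it reaches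
    every [k]-subset of the [d]-set, because [m <= d]. *)
Lemma leq_bin_mul_bin (k m d : nat) :
  (k <= m)%N -> (m <= d)%N -> ('C(d, k) <= 'C(m, k) * 'C(d, m))%N.
Proof.
move=> le_km le_md; have le_kd := leq_trans le_km le_md.
have fact_pos j : (0 < j`!)%N by exact: fact_gt0.
have -> : ('C(m, k) * 'C(d, m) = 'C(d, k) * 'C(d - k, m - k))%N.
  apply/eqP; rewrite -(eqn_pmul2r (fact_pos k)) -(eqn_pmul2r (fact_pos (m - k)%N)).
  rewrite -(eqn_pmul2r (fact_pos (d - m)%N)); apply/eqP.
  have h1 := bin_fact le_km; have h2 := bin_fact le_md.
  have h3 := bin_fact le_kd.
  have h4 := bin_fact (leq_sub2r k le_md).
  rewrite subnBA // subnK // in h4.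
  transitivity d`!.
    by rewrite -h2 -h1; ring.
  by rewrite -h3 -h4; ring.
by rewrite leq_pmulr // bin_gt0 leq_sub2r.
Qed.

(** The first term covers the degrees [d <= r], for which the second one
    vanishes, and the second term covers the others. *)
Lemma leq_bin_star (k r d : nat) : (k <= r)%N ->
  ('C(d, k) <= 'C(r, k) + 'C(r.+1, k) * 'C(d, r.+1))%N.
Proof.
move=> le_kr; case: (leqP d r) => [le_dr | lt_rd].
  by rewrite (leq_trans (leq_bin2l k le_dr)) ?leq_addr.
by rewrite (leq_trans (leq_bin_mul_bin (leqW le_kr) lt_rd)) ?leq_addl.
Qed.

Lemma mul_num_cliques_le_stars (T : finType) (e : rel T) (k r : nat) :
  (k <= r)%N ->
  (k.+1 * num_cliques e k.+1
    <= #|T| * 'C(r, k) + 'C(r.+1, k) * num_stars e r.+1)%N.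
Proof.
move=> le_kr; apply: leq_trans (mul_num_cliques_le e k) _.
rewrite /num_stars -sum_nat_const big_distrr -big_split /=.
by apply: leq_sum => v _; exact: leq_bin_star.
Qed.

Theorem theorem1p9 (R : realFieldType) (t r : nat)
    (ht : (2 <= t)%N) (htr : (t <= r)%N) (eps : R) (heps : 0 < eps) :
  exists delta : R, 0 < delta /\
    forall (T : finType) (e : rel T), symmetric e -> irreflexive e ->
      (1 + eps) * (#|T|%:R / r.+1%:R) * 'C(r.+1, t)%:R
        <= (num_cliques e t)%:R :> R ->
      delta * #|T|%:R <= (num_stars e r.+1)%:R :> R.
Proof.
case: t ht htr => // k _ lt_kr; have le_kr := ltnW lt_kr.
have bin_pos m : (k <= m)%N -> 0 < 'C(m, k)%:R :> R.
  by move=> le_km; rewrite ltr0n bin_gt0.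
have a_pos := bin_pos _ le_kr; have b_pos := bin_pos _ (leqW le_kr).
exists (eps * 'C(r, k)%:R / 'C(r.+1, k)%:R); split.
  by rewrite divr_gt0 ?mulr_gt0.
move=> T e _ _ many_cliques.
have := mul_num_cliques_le_stars e le_kr.
rewrite -(ler_nat R) natrD !natrM => few_cliques.
have : k.+1%:R * ((1 + eps) * (#|T|%:R / r.+1%:R) * 'C(r.+1, k.+1)%:R)
         <= k.+1%:R * (num_cliques e k.+1)%:R :> R.
  by rewrite ler_pM2l ?ltr0Sn.
(* This cancels the [r + 1] in the threshold, leaving the bound that a graph
   of maximum degree [r] would satisfy, times [1 + eps]. *)
have absorb : k.+1%:R * 'C(r.+1, k.+1)%:R = r.+1%:R * 'C(r, k)%:R :> R.
  by rewrite -!natrM -mul_bin_diag.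
have -> : k.+1%:R * ((1 + eps) * (#|T|%:R / r.+1%:R) * 'C(r.+1, k.+1)%:R)
            = (1 + eps) * #|T|%:R * 'C(r, k)%:R :> R.
  by rewrite mulrCA absorb !mulrA divfK ?pnatr_eq0.
move=> /le_trans/(_ few_cliques) excess.
rewrite mulrAC ler_pdivrMr // (mulrC _ 'C(r.+1, k)%:R).
by lra.
Qed.
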